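(* Let $k\ge1$. For generic $\bar\lambda_1,\dots,\bar\lambda_k$, $\bar\sigma_1^2,\dots,\bar\sigma_k^2$ and $\bar m_1,\dots,\bar m_k$, the polynomial system \[ h_i(\mu):=\sum_{\ell=1}^k\bar\lambda_\ell\, M_i(\mu_\ell,\bar\sigma_\ell^2)-\bar m_i=0,\qquad i=1,\dots,k, \] in the unknowns $\mu_1,\dots,\mu_k$ has finitely many complex solutions (i.e., the $\lambda$-weighted, known-variance Gaussian $k$-mixture model is algebraically identifiable from these moment equations), and the number of its complex solutions is $k!$.
   Context: Define polynomials $M_i(\mu,s)$ for $i\ge 0$ by $M_0=1$, $M_1=\mu$, $M_i=\mu M_{i-1}+(i-1)\,s\,M_{i-2}$ for $i\ge2$ ($M_i(\mu,\sigma^2)$ is the $i$-th moment of $\mathcal N(\mu,\sigma^2)$). Here the mixing weights and variances are known and only the means are unknown. ''Generic'' means outside a proper Zariski-closed subset of parameter space. *)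

(* Defs.v *)
From HB Require Import structures.
From mathcomp Require Import all_boot all_order all_algebra.
From mathcomp Require Import complex.
From mathcomp Require Import reals.
From mathcomp Require Import mpoly.
Set Implicit Arguments. Unset Strict Implicit. Unset Printing Implicit Defensive.
Import Order.TTheory GRing.Theory Num.Theory.
Local Open Scope ring_scope.

Fixpoint gmom {F : pzRingType} (mu s : F) (i : nat) : F :=
  match i with
  | 0 => 1
  | i1.+1 =>
    match i1 with
    | 0 => mu
    | i2.+1 => mu * gmom mu s i1 + i1%:R * s * gmom mu s i2
    end
  end.

(* h_i(mu) = sum_l lam_l M_i(mu_l, sig_l) - m_i, for i = 1..k (index i : 'I_k means i.+1). *)
Definition hsys {F : pzRingType} (k : nat) (lam sig m mu : 'I_k -> F) (i : 'I_k) : F :=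
  \sum_(l < k) lam l * gmom (mu l) (sig l) i.+1 - m i.

Definition params {F : Type} (k : nat) (lam sig m : 'I_k -> F) : 'I_(k + (k + k)) -> F :=
  fun j => match split j with
           | inl a => lam a
           | inr b => match split b with inl c => sig c | inr d => m d end
           end.

(* Main.v *)
Require Import Defs.
From HB Require Import structures.
From mathcomp Require Import all_boot all_order all_fingroup all_algebra all_field.
From mathcomp Require Import complex.
From mathcomp Require Import reals.
From mathcomp Require Import ssrcomplements mpoly.
Import Order.TTheory GRing.Theory Num.Theory.
Set Implicit Arguments. Unset Strict Implicit. Unset Printing Implicit Defensive.
Local Open Scope ring_scope.

(** Write h_j (0 <= j < k) for the equations, of degree j+1, and send each
monomial X^n to G_n := X^r h^q, where n_j = r_j + (j+1) q_j with r_j <= j.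
This preserves degrees, so the G_n of bounded degree are expressed in the
monomials by a square matrix.  If one such matrix of large enough size is
invertible, C[X] is free over C[h] with basis the k! monomials X^r, and these
form a basis of C[X]/(h).  Let u be a linear form.  If multiplication by u on
the quotient has k! distinct eigenvalues, then its eigenvectors (acting on
functionals) are exactly the evaluations at the solutions, so there are k! of
them.  Both conditions are the nonvanishing of polynomials in the parameters
(a determinant and a resultant).  Neither polynomial is zero: take all weights
1, all variances 0 and all moments the power sums of 0, ..., k-1.  The system
then has the k! permutations of (0, ..., k-1) as solutions, separated by a
suitable u, and the G_n are independent because the power sums are
algebraically independent (Jacobian criterion) and the monomials X^r are
independent over symmetric polynomials. *)

(** * Expansion in the products X^r h^q *)

Section DegreeBounds.
Variables (k : nat) (F : comNzRingType).
Implicit Types p q : {mpoly F[k]}.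

Lemma msize_leM p q a b :
  (msize p <= a.+1 -> msize q <= b.+1 -> msize (p * q) <= (a + b).+1)%N.
Proof.
move=> pa qb; have [->|pq0] := eqVneq (p * q) 0; first by rewrite msize0.
have p0 : p != 0 by apply: contraNneq pq0 => ->; rewrite mul0r.
have q0 : q != 0 by apply: contraNneq pq0 => ->; rewrite mulr0.
rewrite -mlead_deg // ltnS in pa; rewrite -mlead_deg // ltnS in qb.
rewrite -mlead_deg // ltnS; apply: leq_trans (lemc_mdeg (mleadM_le p q)) _.
by rewrite mdegD leq_add.
Qed.

Lemma msize_leD p q a :
  (msize p <= a -> msize q <= a -> msize (p + q) <= a)%N.
Proof.
by move=> pa qa; apply: leq_trans (msizeD_le p q) _; rewrite geq_max pa.
Qed.

Lemma msize_le_sum (I : Type) (r : seq I) (P : pred I) (f : I -> {mpoly F[k]}) a :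
  (forall i, P i -> msize (f i) <= a)%N -> (msize (\sum_(i <- r | P i) f i) <= a)%N.
Proof.
move=> fa; elim/big_rec: _ => [|i p Pi pa]; first by rewrite msize0.
by apply: msize_leD => //; apply: fa.
Qed.

Lemma msize_leX p a n : (msize p <= a.+1 -> msize (p ^+ n) <= (a * n).+1)%N.
Proof.
move=> pa; elim: n => [|n IHn]; first by rewrite expr0 msize1.
by rewrite exprS mulnS; apply: msize_leM.
Qed.

Lemma msize_le_mmap1 (h : 'I_k -> {mpoly F[k]}) (w : 'I_k -> nat) (m : 'X_{1..k}) :
  (forall i, msize (h i) <= (w i).+1)%N ->
  (msize (mmap1 h m) <= (\sum_i w i * m i).+1)%N.
Proof.
move=> hw; rewrite /mmap1.
elim/big_rec2: _ => [|i a p _ pa]; first by rewrite msize1.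
by apply: msize_leM => //; apply: msize_leX.
Qed.

Lemma msize_leC (c : F) a : (msize (c%:MP_[k]) <= a.+1)%N.
Proof. by rewrite msizeC (leq_trans (leq_b1 _)). Qed.

End DegreeBounds.

Section Expansion.
Variables (k : nat).

Definition mrem (n : 'X_{1..k}) : 'X_{1..k} := [multinom (n i %% i.+1)%N | i < k].
Definition mquo (n : 'X_{1..k}) : 'X_{1..k} := [multinom (n i %/ i.+1)%N | i < k].
Definition mdil (n : 'X_{1..k}) : 'X_{1..k} := [multinom (n i * i.+1)%N | i < k].

Lemma mquo_rem n : n = (mrem n + mdil (mquo n))%MM.
Proof. by apply/mnmP=> i; rewrite mnmDE !mnmE addnC -divn_eq. Qed.

Lemma mremD n a : mrem (n + mdil a)%MM = mrem n.
Proof. by apply/mnmP=> i; rewrite !mnmE addnC modnMDl. Qed.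

Lemma mquoD n a : mquo (n + mdil a)%MM = (mquo n + a)%MM.
Proof. by apply/mnmP=> i; rewrite !mnmE addnC divnMDl // addnC. Qed.

Lemma mdeg_mdil n : mdeg (mdil n) = (\sum_(i < k) i.+1 * n i)%N.
Proof. by rewrite mdegE; apply: eq_bigr => i _; rewrite mnmE mulnC. Qed.

Definition bmon d (j : 'I_#|{: 'X_{1..k < d}}|) : 'X_{1..k} :=
  (enum_val j : 'X_{1..k < d}).

Lemma bmon_inj d : injective (@bmon d).
Proof. by move=> i j /val_inj/enum_val_inj. Qed.

Lemma mdeg_bmon d (j : 'I_#|{: 'X_{1..k < d}}|) : (mdeg (bmon j) < d)%N.
Proof. exact: bmdeg. Qed.

Section Ring.
Variables (F : comNzRingType) (h : 'I_k -> {mpoly F[k]}).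
Hypothesis hdeg : forall i, (msize (h i) <= i.+2)%N.

(** These are the products G_n. Dividing each n_i with remainder by i+1, the degree bound of h_i,
    gives them the same index set as the monomials. *)
Definition hbas (n : 'X_{1..k}) : {mpoly F[k]} := 'X_[mrem n] * mmap1 h (mquo n).

Lemma msize_hbas n : (msize (hbas n) <= (mdeg n).+1)%N.
Proof.
rewrite {2}(mquo_rem n) mdegD mdeg_mdil; apply: msize_leM.
  by rewrite msizeX.
exact: (msize_le_mmap1 (w := fun i : 'I_k => i.+1)).
Qed.

Lemma mmap1D a b : mmap1 h (a + b)%MM = mmap1 h a * mmap1 h b.
Proof. by apply: commr_mmap1_M => i x; apply: mulrC. Qed.

Lemma hbasD n a : hbas (n + mdil a)%MM = hbas n * mmap1 h a.
Proof. by rewrite /hbas mremD mquoD mmap1D mulrA. Qed.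

(** For this map X^n -> G_n, injectivity says that h is algebraically independent and the X^r are
    independent over F[h]; surjectivity says that the X^r span over F[h]. *)
Definition hexp (c : {mpoly F[k]}) := \sum_(n <- msupp c) c@_n *: hbas n.

Lemma hexpE d c : (msize c <= d)%N ->
  hexp c = \sum_(n : 'X_{1..k < d}) c@_n *: hbas n.
Proof.
move=> le_cd; pose I : subFinType _ := 'X_{1..k < d}.
rewrite /hexp (big_mksub I) //=; first last.
  by move=> x /msize_mdeg_lt /leq_trans; apply.
  by rewrite msupp_uniq.
by rewrite big_rmcond //= => i; move/memN_msupp_eq0 ->; rewrite scale0r.
Qed.

Lemma hexp_is_linear : linear hexp.
Proof.
move=> a p q; pose d := maxn (msize (a *: p + q)) (maxn (msize p) (msize q)).
rewrite !(@hexpE d) ?leq_max ?leqnn ?orbT //.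
rewrite scaler_sumr -big_split /=; apply: eq_bigr => n _.
by rewrite mcoeffD mcoeffZ scalerDl scalerA.
Qed.
HB.instance Definition _ :=
  GRing.isLinear.Build F {mpoly F[k]} {mpoly F[k]} _ hexp hexp_is_linear.

Lemma hexp_sum (I : Type) (r : seq I) (P : pred I) (f : I -> {mpoly F[k]}) :
  hexp (\sum_(i <- r | P i) f i) = \sum_(i <- r | P i) hexp (f i).
Proof. exact: (linear_sum hexp). Qed.

Lemma hexpZ a p : hexp (a *: p) = a *: hexp p.
Proof. exact: (linearZ_LR hexp). Qed.

Lemma hexpX n : hexp 'X_[n] = hbas n.
Proof. by rewrite /hexp msuppX big_seq1 mcoeffX eqxx scale1r. Qed.

Lemma msize_hexp c : (msize (hexp c) <= msize c)%N.
Proof.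
rewrite /hexp big_seq; apply: msize_le_sum => n /msize_mdeg_lt lt_n.
by apply: leq_trans (msizeZ_le _ _) (leq_trans (msize_hbas n) lt_n).
Qed.

(** Shifting n by [mdil a] keeps the remainder and adds a to the quotient. Thus [hexp] turns a
    dilated monomial factor into the matching product of powers of h. *)
Lemma hexp_mul c a : hexp (c * 'X_[mdil a]) = hexp c * mmap1 h a.
Proof.
rewrite [c]mpolyE mulr_suml !hexp_sum mulr_suml; apply: eq_bigr => n _.
by rewrite -scalerAl !hexpZ -mpolyXD !hexpX hbasD scalerAl.
Qed.

Definition hmx d : 'M[F]_#|{: 'X_{1..k < d}}| :=
  \matrix_(i, j) (hbas (bmon i))@_(bmon j).
Definition mpoly_row d (p : {mpoly F[k]}) : 'rV[F]_#|{: 'X_{1..k < d}}| :=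
  \row_j p@_(bmon j).
Definition row_mpoly d (v : 'rV[F]_#|{: 'X_{1..k < d}}|) : {mpoly F[k]} :=
  \sum_j v 0 j *: 'X_[bmon j].

Lemma msize_row_mpoly d (v : 'rV_#|{: 'X_{1..k < d}}|) : (msize (row_mpoly v) <= d)%N.
Proof.
apply: msize_le_sum => j _; apply: leq_trans (msizeZ_le _ _) _.
by rewrite msizeX mdeg_bmon.
Qed.

Lemma row_mpolyK d (v : 'rV_#|{: 'X_{1..k < d}}|) : mpoly_row d (row_mpoly v) = v.
Proof.
apply/rowP=> j; rewrite mxE raddf_sum (bigD1 j) //= big1 ?addr0.
  by rewrite mcoeffZ mcoeffX eqxx mulr1.
move=> i ij; rewrite mcoeffZ mcoeffX; case: eqP => [|_]; last by rewrite mulr0.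
by move/bmon_inj/eqP; rewrite (negPf ij).
Qed.

Lemma mpoly_rowK d p : (msize p <= d)%N -> row_mpoly (mpoly_row d p) = p.
Proof.
move=> pd; rewrite [RHS](mpolywE pd) /row_mpoly.
rewrite [RHS](reindex (@enum_val _ {: 'X_{1..k < d}})).
  by apply: eq_bigr => j _; rewrite mxE.
exact/onW_bij/enum_val_bij.
Qed.

Lemma mpoly_row_hexp d c : (msize c <= d)%N ->
  mpoly_row d (hexp c) = mpoly_row d c *m hmx d.
Proof.
move=> cd; rewrite -{1}(mpoly_rowK cd) /row_mpoly; apply/rowP=> j.
rewrite mxE hexp_sum raddf_sum mxE; apply: eq_bigr => i _ /=.
by rewrite hexpZ hexpX mcoeffZ !mxE.
Qed.

End Ring.

(** Allows the matrix to be formed over the ring of parameters and specialized afterwards. *)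
Lemma map_hmx (F F' : comNzRingType) (f : {rmorphism F -> F'})
    (h : 'I_k -> {mpoly F[k]}) d :
  map_mx f (hmx h d) = hmx (fun i => map_mpoly f (h i)) d.
Proof.
apply/matrixP=> i j; rewrite !mxE -mcoeff_map_mpoly rmorphM /=.
rewrite map_mpolyX /mmap1 rmorph_prod; congr (mcoeff _ (_ * _)).
by apply: eq_bigr => l _; rewrite rmorphXn.
Qed.

Section Field.
Variables (F : fieldType) (h : 'I_k -> {mpoly F[k]}).
Hypothesis hdeg : forall i, (msize (h i) <= i.+2)%N.

Lemma hexp_surj_deg d q : hmx h d \in unitmx -> (msize q <= d)%N ->
  exists2 c, (msize c <= d)%N & hexp h c = q.
Proof.
move=> Tu qd; pose c := row_mpoly (mpoly_row d q *m invmx (hmx h d)).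
exists c; first exact: msize_row_mpoly.
have cd : (msize c <= d)%N by exact: msize_row_mpoly.
rewrite -(mpoly_rowK (leq_trans (msize_hexp hdeg c) cd)) mpoly_row_hexp //.
by rewrite row_mpolyK mulmxKV // mpoly_rowK.
Qed.

(** The expansions of the single monomials are the rows of a left inverse, and the matrix is
    square. *)
Lemma hexp_surj_unit d :
  (forall q, msize q <= d -> exists2 c, (msize c <= d)%N & hexp h c = q)%N ->
  hmx h d \in unitmx.
Proof.
move=> hs; have /fin_all_exists [c hc] (i : 'I_#|{: 'X_{1..k < d}}|) :
    exists v : 'rV_#|{: 'X_{1..k < d}}|, v *m hmx h d = delta_mx 0 i.
  have [|c cd hc] := hs 'X_[bmon i]; first by rewrite msizeX mdeg_bmon.
  exists (mpoly_row d c); rewrite -mpoly_row_hexp // hc.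
  apply/rowP=> j; rewrite !mxE mcoeffX eqxx /=.
  by rewrite (inj_eq (@bmon_inj d)) eq_sym.
suff E : (\matrix_i c i) *m hmx h d = 1%:M by case/mulmx1_unit: E.
by apply/row_matrixP=> i; rewrite row_mul rowK hc row1.
Qed.

End Field.
End Expansion.

(** * From invertibility in one degree to a bijection in all degrees *)

Section Bijection.
Variables (k : nat) (F : fieldType) (h : 'I_k -> {mpoly F[k]}).
Hypothesis hdeg : forall i, (msize (h i) <= i.+2)%N.

(** Rows killed by [hmx] are the coefficient rows of the kernel of [hexp] in degree below d; the
    degree bound on [hexp] ensures that truncation loses no coefficient. *)
Lemma hmx_unitP d :
  reflect (forall c, (msize c <= d)%N -> hexp h c = 0 -> c = 0) (hmx h d \in unitmx).
Proof.
apply: (iffP idP) => [Tu c cd c0|hinj].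
  rewrite -(mpoly_rowK cd); suff -> : mpoly_row d c = 0.
    by rewrite /row_mpoly big1 // => j _; rewrite mxE scale0r.
  apply: (can_inj (mulmxK Tu)); rewrite -mpoly_row_hexp // c0 mul0mx.
  by apply/rowP=> j; rewrite !mxE mcoeff0.
rewrite unitmxE unitfE; apply/det0P=> -[v v0 vT].
case/eqP: v0; rewrite -(row_mpolyK v).
suff -> : row_mpoly v = 0 by apply/rowP=> j; rewrite !mxE mcoeff0.
have vd := msize_row_mpoly v; apply: hinj => //.
rewrite -(mpoly_rowK (leq_trans (msize_hexp hdeg _) vd)).
rewrite mpoly_row_hexp // row_mpolyK vT /row_mpoly big1 // => j _.
by rewrite mxE scale0r.
Qed.

Definition hspan d (q : {mpoly F[k]}) := exists2 c, (msize c <= d)%N & hexp h c = q.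

Lemma hspan_sum d (I : eqType) (r : seq I) (f : I -> {mpoly F[k]}) (a : I -> F) :
  (forall i, i \in r -> hspan d (f i)) -> hspan d (\sum_(i <- r) a i *: f i).
Proof.
elim: r => [|i r IHr] fs.
  by rewrite big_nil; exists 0; rewrite ?msize0 // linear0.
have [|c cd hc] := IHr; first by move=> j jr; apply: fs; rewrite inE jr orbT.
have [b bd hb] := fs i (mem_head _ _).
exists (a i *: b + c); last by rewrite big_cons linearP /= hb hc.
by apply: msize_leD => //; apply: leq_trans (msizeZ_le _ _) bd.
Qed.

Lemma mdeg_mrem (n : 'X_{1..k}) : (mdeg (mrem n) <= k * k)%N.
Proof.
rewrite mdegE -[X in (_ <= X * _)%N]card_ord -sum_nat_const.
apply: leq_sum => i _; rewrite mnmE; apply: leq_trans (ltn_ord i).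
by rewrite ltnW // ltn_pmod.
Qed.

Lemma hmx_unit_leq d d' : (d' <= d)%N -> hmx h d \in unitmx -> hmx h d' \in unitmx.
Proof.
move=> dd /hmx_unitP hi; apply/hmx_unitP => c cd; apply: hi.
exact: leq_trans cd dd.
Qed.

Hypothesis Tu : hmx h (k * k).+2 \in unitmx.

(* Only the matrix of size d = k^2+2 is assumed invertible: degree k^2+1 covers
   all X_j X^r, and multiplying such expansions by powers of h reaches every degree. *)
Lemma hspanX m : hspan (mdeg m).+1 'X_[m].
Proof.
move: {2}(mdeg m) (erefl (mdeg m)) => n; elim: n m => [|n IHn] m mn.
  by rewrite mn; apply: hexp_surj_deg; rewrite ?(hmx_unit_leq _ Tu) // msizeX mn.
have [j mj] : exists j, (0 < m j)%N.
  case: (pickP (fun j => 0 < m j)%N) => [j mj|m0]; first by exists j.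
  suff m00 : m = 0%MM by rewrite m00 mdeg0 in mn.
  by apply/mnmP=> i; rewrite mnm0E; have := m0 i; case: (m i).
have mE : m = ((m - U_(j)) + U_(j))%MM.
  by rewrite submK // lep1mP -lt0n.
have degm : mdeg (m - U_(j))%MM = n.
  by apply/eqP; rewrite -eqSS -mn {2}mE mdegD mdeg1 addn1.
have [c cd hc] := IHn _ degm; rewrite degm in cd.
rewrite mE mpolyXD -hc /hexp mulr_suml.
under eq_bigr do rewrite -scalerAl.
apply: hspan_sum => i ic.
have Td : hmx h (mdeg (mrem i + U_(j))%MM).+1 \in unitmx.
  by apply: hmx_unit_leq Tu; rewrite ltnS mdegD mdeg1 addn1 ltnS mdeg_mrem.
have [b bd hb] := hexp_surj_deg hdeg Td (eq_leq (msizeX _ _)).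
exists (b * 'X_[mdil (mquo i)]); last first.
  by rewrite hexp_mul hb /hbas mpolyXD mulrAC.
(* With r and q the remainder and quotient of i, b has degree at most |r|+1 and the monomial factor
   has degree |i|-|r|, so their product has degree at most |i|+1 <= n+1. *)
have lti : (mdeg i < n.+1)%N := leq_trans (msize_mdeg_lt ic) cd.
rewrite -mE mn; apply: leq_trans (_ : (mdeg i).+2 <= _)%N; last by rewrite ltnS.
rewrite {2}(mquo_rem i) mdegD -addSn.
apply: msize_leM; last by rewrite msizeX.
by apply: leq_trans bd _; rewrite mdegD mdeg1 addn1.
Qed.

Lemma hexp_surj q : exists2 c, (msize c <= msize q)%N & hexp h c = q.
Proof.
rewrite {2}(mpolyE q); apply: hspan_sum => m mq.
have [c cd hc] := hspanX m; exists c => //.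
exact: leq_trans cd (msize_mdeg_lt mq).
Qed.

(** Surjectivity respects degree bounds, so every square matrix [hmx] is invertible, and this
    returns injectivity in every degree. *)
Lemma hexp_inj : injective (hexp h).
Proof.
move=> a b ab; apply/eqP; rewrite -subr_eq0; apply/eqP.
have /hmx_unitP : hmx h (msize (a - b)) \in unitmx.
  apply: hexp_surj_unit => q qd; have [c cq hc] := hexp_surj q.
  by exists c => //; apply: leq_trans cq qd.
by apply=> //; rewrite linearB /= ab subrr.
Qed.

End Bijection.

(** * The quotient by the ideal (h) *)

(* The exponents r with r_j <= j, which index the basis X^r of the quotient. *)
Definition stair (k : nat) := {dffun forall i : 'I_k, 'I_i.+1}.
HB.instance Definition _ k := Finite.on (stair k).

Section Stair.
Variable k : nat.
Implicit Types e : stair k.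

Lemma card_stair : #|{: stair k}| = k`!.
Proof.
rewrite card_dep_ffun.
rewrite foldrE big_map big_enum /= fact_prod big_add1 big_mkord.
by apply: eq_bigr => i _; rewrite card_ord.
Qed.

Definition smon e : 'X_{1..k} := [multinom (e i : nat) | i < k].

Lemma smon_inj : injective smon.
Proof.
move=> e e' /mnmP ee; apply/ffunP=> i; apply/val_inj.
by have := ee i; rewrite !mnmE.
Qed.

Lemma mdeg_smon e : (mdeg (smon e) <= k * k)%N.
Proof.
rewrite mdegE -[X in (_ <= X * _)%N]card_ord -sum_nat_const.
by apply: leq_sum => i _; rewrite mnmE; apply: leq_trans (leq_ord _) (ltnW _).
Qed.

Definition srem (m : 'X_{1..k}) : stair k :=
  [ffun i : 'I_k => Ordinal (ltn_pmod (m i) (ltn0Sn i)) : 'I_i.+1].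

Lemma smon_srem m : smon (srem m) = mrem m.
Proof. by apply/mnmP=> i; rewrite !mnmE ffunE. Qed.

Lemma mrem_smon e : mrem (smon e) = smon e.
Proof. by apply/mnmP=> i; rewrite !mnmE modn_small. Qed.

Lemma mquo_smon e : mquo (smon e) = 0%MM.
Proof. by apply/mnmP=> i; rewrite !mnmE divn_small. Qed.

Lemma smonP m : reflect (exists e, m = smon e) (mquo m == 0%MM).
Proof.
apply: (iffP eqP) => [m0|[e ->]]; last exact: mquo_smon.
exists (srem m); rewrite smon_srem {1}(mquo_rem m) m0.
by apply/mnmP=> i; rewrite mnmDE !mnmE mul0n addn0.
Qed.

End Stair.

Section Quotient.
Variables (k : nat) (F : fieldType) (h : 'I_k -> {mpoly F[k]}).
Hypothesis hdeg : forall i, (msize (h i) <= i.+2)%N.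
Hypothesis Tu : hmx h (k * k).+2 \in unitmx.

Lemma hexp_eq_ex q : exists c, hexp h c == q.
Proof. by have [c _ <-] := hexp_surj hdeg Tu q; exists c. Qed.

Definition hinv q := xchoose (hexp_eq_ex q).

Lemma hinvK q : hexp h (hinv q) = q.
Proof. exact/eqP/(xchooseP (hexp_eq_ex q)). Qed.

Lemma hexpK c : hinv (hexp h c) = c.
Proof. by apply: (hexp_inj hdeg Tu); rewrite hinvK. Qed.

Lemma hinv_is_linear : linear hinv.
Proof.
by move=> a p q; apply: (hexp_inj hdeg Tu); rewrite linearP /= !hinvK.
Qed.
HB.instance Definition _ :=
  GRing.isLinear.Build F {mpoly F[k]} {mpoly F[k]} _ hinv hinv_is_linear.

Lemma hinv_smon e : hinv 'X_[smon e] = 'X_[smon e].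
Proof.
rewrite -[RHS]hexpK hexpX /hbas mrem_smon mquo_smon.
by rewrite /mmap1 big1 ?mulr1 // => i _; rewrite mnm0E expr0.
Qed.

(** For linear [phi] this says that [phi] factors through the quotient by the ideal (h). *)
Definition vanishing (phi : {mpoly F[k]} -> F) := forall q i, phi (q * h i) = 0.

(** Every G_m with nonzero quotient part contains a factor h_i and is killed by [phi]; only the k!
    terms X^e survive. *)
Lemma vanishing_stair (phi : {linear {mpoly F[k]} -> F^o}) q : vanishing phi ->
  phi q = \sum_(e : stair k) (hinv q)@_(smon e) * phi 'X_[smon e].
Proof.
move=> v; rewrite -{1}(hinvK q); move: (hinv q) => c {q}.
rewrite [c]mpolyE hexp_sum linear_sum /=.
under [RHS]eq_bigr do rewrite raddf_sum mulr_suml.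
rewrite exchange_big /=; apply: eq_bigr => m _.
rewrite hexpZ linearZ /= hexpX.
under eq_bigr do rewrite mcoeffZ mcoeffX -mulrA.
rewrite -mulr_sumr; congr (_ * _); case: (smonP m) => [[e ->]|nm].
  rewrite (bigD1 e) //= eqxx mul1r big1 ?addr0 => [|e' ee'].
    rewrite -[LHS]/(phi (hbas h _)) /hbas mrem_smon mquo_smon.
    by rewrite /mmap1 big1 ?mulr1 // => i _; rewrite mnm0E expr0.
  by rewrite (inj_eq (@smon_inj k)) eq_sym (negPf ee') mul0r.
rewrite big1 => [|e _]; last first.
  by case: eqP => [me|_]; [case: nm; exists e | rewrite mul0r].
have [i mi] : exists i, (0 < mquo m i)%N.
  case: (pickP (fun j => 0 < mquo m j)%N) => [j mj|m0]; first by exists j.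
  case: nm; apply/smonP/eqP/mnmP=> i; rewrite mnm0E.
  by have := m0 i; case: (mquo m i).
rewrite /hbas /mmap1 (bigD1 i) //= -(prednK mi) exprS -mulrA mulrC -mulrA mulrC.
exact: v.
Qed.

(** Converse construction to [vanishing_stair]: the functional with prescribed values w on the X^e.
    The staircase coefficients of [hinv q] are the coordinates of q in the quotient. *)
Definition sfun (w : 'rV[F]_#|{: stair k}|) (q : {mpoly F[k]}) : F^o :=
  \sum_(e : stair k) w 0 (enum_rank e) * (hinv q)@_(smon e).

Lemma sfun_is_linear w : linear (sfun w).
Proof.
move=> a p q; rewrite /sfun scaler_sumr -big_split; apply: eq_bigr => e _ /=.
by rewrite linearP mcoeffD mcoeffZ mulrDr mulrCA.
Qed.
HB.instance Definition _ w :=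
  GRing.isLinear.Build F {mpoly F[k]} F^o _ (sfun w) (sfun_is_linear w).

(** Multiplying q by h_i raises the i-th exponents of [hinv q] by i+1, which moves all of them out
    of the staircase. *)
Lemma sfun_vanishing w : vanishing (sfun w).
Proof.
move=> q i; rewrite /sfun big1 // => e _.
have -> : hinv (q * h i) = hinv q * 'X_[mdil U_(i)].
  by apply: (hexp_inj hdeg Tu); rewrite hexp_mul !hinvK mmap1U.
rewrite [hinv q]mpolyE mulr_suml raddf_sum big1 ?mulr0 // => m _ /=.
rewrite -scalerAl -mpolyXD mcoeffZ mcoeffX.
case: eqP => [/mnmP/(_ i)|_]; last by rewrite mulr0.
rewrite mnmDE !mnmE eqxx mul1n => mi; have := ltn_ord (e i).
by rewrite -mi ltnNge leq_addl.
Qed.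

Lemma sfun_smon w e : sfun w 'X_[smon e] = w 0 (enum_rank e).
Proof.
rewrite /sfun hinv_smon (bigD1 e) //= mcoeffX eqxx mulr1 big1 ?addr0 // => e' ne.
by rewrite mcoeffX (inj_eq (@smon_inj k)) eq_sym (negPf ne) mulr0.
Qed.

(** Multiplication by u on the quotient, with images as columns, so that row vectors, read as
    functionals, are acted on from the right. *)
Definition mulmx_stair (u : {mpoly F[k]}) : 'M[F]_#|{: stair k}| :=
  \matrix_(i, j) (hinv (u * 'X_[smon (enum_val j)]))@_(smon (enum_val i)).

Lemma mulmx_stairE u w e :
  (w *m mulmx_stair u) 0 (enum_rank e) = sfun w (u * 'X_[smon e]).
Proof.
rewrite mxE /sfun (reindex_onto enum_rank enum_val) /=; last first.
  by move=> i _; rewrite enum_valK.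
apply: eq_big => e'; first by rewrite enum_rankK eqxx.
by rewrite mxE !enum_rankK.
Qed.

End Quotient.

(** * Solutions as eigenvalues *)

(** The n eigenspaces are nonzero and their sum is direct in dimension n, so each of them is a
    line. *)
Lemma eigenspace_line (F : fieldType) n (A : 'M[F]_n) (a : 'I_n -> F) :
    injective a -> (forall i, eigenvalue A (a i)) ->
  forall i (v w : 'rV_n), v *m A = a i *: v -> w *m A = a i *: w -> w != 0 ->
  exists b, v = b *: w.
Proof.
move=> ainj eig i v w /eigenspaceP vE /eigenspaceP wE w0.
have rge j : (1 <= \rank (eigenspace A (a j)))%N.
  by rewrite lt0n mxrank_eq0; apply: eig.
have /mxdirectP /= dx := mxdirect_sum_eigenspace A (P := xpredT) (a_ := a) (in2W ainj).
have rle : (\sum_j \rank (eigenspace A (a j)) <= n)%N.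
  by rewrite -dx rank_leq_row.
have r1 : \rank (eigenspace A (a i)) = 1%N.
  apply/eqP; rewrite eqn_leq rge andbT leqNgt; apply/negP=> r2.
  move: rle; rewrite (bigD1 i) //= leqNgt => /negP[].
  have : (\sum_(j < n | j != i) 1 <= \sum_(j < n | j != i) \rank (eigenspace A (a j)))%N.
    by apply: leq_sum.
  rewrite sum1_card => le1; apply: leq_trans (leq_add r2 le1).
  by rewrite cardC1 card_ord addSn ltnS add1n leqSpred.
have rw : \rank w = 1%N by rewrite rank_rV w0.
have /eqmxP Ew : (w == eigenspace A (a i))%MS.
  rewrite wE /= -(geq_leqif (mxrank_leqif_sup wE)) r1 rw //.
by apply/sub_rVP; rewrite Ew.
Qed.

Section Solutions.
Variables (k : nat) (F : fieldType) (h : 'I_k -> {mpoly F[k]}).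
Hypothesis hdeg : forall i, (msize (h i) <= i.+2)%N.
Hypothesis Tu : hmx h (k * k).+2 \in unitmx.
Variable u : {mpoly F[k]}.

Let A := mulmx_stair hdeg Tu u.

Definition mulfun (p : {mpoly F[k]}) (phi : {mpoly F[k]} -> F^o) q : F^o := phi (p * q).

Lemma mulfun_is_linear p (phi : {linear {mpoly F[k]} -> F^o}) : linear (mulfun p phi).
Proof. by move=> a q r; rewrite /mulfun mulrDr -scalerAr linearP. Qed.
HB.instance Definition _ p (phi : {linear {mpoly F[k]} -> F^o}) :=
  GRing.isLinear.Build F {mpoly F[k]} F^o _ (mulfun p phi) (mulfun_is_linear p phi).

Lemma mulfun_vanishing p (phi : {linear {mpoly F[k]} -> F^o}) :
  vanishing h phi -> vanishing h (mulfun p phi).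
Proof. by move=> v q i; rewrite /mulfun mulrA; apply: v. Qed.

Definition evalfun (mu : 'I_k -> F) (q : {mpoly F[k]}) : F^o := q.@[mu].

Lemma evalfun_is_linear mu : linear (evalfun mu).
Proof. by move=> a q r; rewrite /evalfun mevalD mevalZ. Qed.
HB.instance Definition _ mu :=
  GRing.isLinear.Build F {mpoly F[k]} F^o _ (evalfun mu) (evalfun_is_linear mu).

Lemma evalfun_vanishing mu :
  (forall i, (h i).@[mu] = 0) -> vanishing h (evalfun mu).
Proof. by move=> h0 q i; rewrite /evalfun mevalM h0 mulr0. Qed.

Definition fun_row (phi : {mpoly F[k]} -> F) : 'rV[F]_#|{: stair k}| :=
  \row_i phi 'X_[smon (enum_val i)].

Lemma sfun_row (phi : {linear {mpoly F[k]} -> F^o}) q :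
  vanishing h phi -> sfun hdeg Tu (fun_row phi) q = phi q.
Proof.
move=> v; rewrite (vanishing_stair hdeg Tu q v).
by apply: eq_bigr => e _; rewrite mxE enum_rankK mulrC.
Qed.

Lemma fun_row_eigen (phi : {linear {mpoly F[k]} -> F^o}) th :
  vanishing h phi -> (forall q, phi (u * q) = th * phi q) ->
  fun_row phi *m A = th *: fun_row phi.
Proof.
move=> v ph; apply/rowP=> j; rewrite -[j]enum_valK mulmx_stairE sfun_row //.
by rewrite ph !mxE enum_rankK.
Qed.

(** Both sides kill the ideal, so it suffices to compare them on the X^e, where the claim is the
    eigenvector equation. *)
Lemma sfun_eigen w th q : w *m A = th *: w ->
  sfun hdeg Tu w (u * q) = th * sfun hdeg Tu w q.
Proof.
move=> wA; have v := sfun_vanishing hdeg Tu w.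
have v' := mulfun_vanishing u v.
rewrite -[LHS]/(mulfun u (sfun hdeg Tu w) q) (vanishing_stair hdeg Tu q v').
rewrite (vanishing_stair hdeg Tu q v) mulr_sumr; apply: eq_bigr => e _.
rewrite [X in _ * X = _](_ : _ = sfun hdeg Tu w (u * 'X_[smon e])) //.
rewrite -mulmx_stairE -/A wA mxE mulrCA; congr (_ * (_ * _)).
by rewrite -(sfun_smon hdeg Tu).
Qed.

(** Turns a common eigenfunctional of all variables into an evaluation, up to the factor [phi 1]. *)
Lemma multiplicative_on_vars (phi : {linear {mpoly F[k]} -> F^o}) (mu : 'I_k -> F) :
  (forall j q, phi ('X_j * q) = mu j * phi q) ->
  forall p q, phi (p * q) = p.@[mu] * phi q.
Proof.
move=> hmu p q; rewrite {1}[p]mpolyE mulr_suml linear_sum mevalE mulr_suml.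
apply: eq_bigr => m _; rewrite -scalerAl linearZ -mulrA /=; congr (_ * _).
rewrite mpolyXE_id; elim/big_rec2: _ q => [|i a b _ IH] q.
  by rewrite !mul1r.
rewrite -!mulrA -IH; elim: (m i) => [|n IHn]; first by rewrite !expr0 !mul1r.
by rewrite !exprS -!mulrA hmu IHn.
Qed.

Variable th : 'I_#|{: stair k}| -> F.
Hypothesis th_inj : injective th.
Hypothesis th_eig : forall i, eigenvalue A (th i).

(* For an eigenfunctional phi, the functional q |-> phi (X_j q) is again an
   eigenfunctional for the same simple eigenvalue, hence equals mu_j phi. *)
Lemma eigen_solution s : exists mu : {ffun 'I_k -> F},
  (forall i, (h i).@[mu] = 0) /\ u.@[mu] = th s.
Proof.
have /eigenvalueP[w wA w0] := th_eig s.
pose phi := sfun hdeg Tu w.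
have v : vanishing h phi := sfun_vanishing hdeg Tu w.
have /fin_all_exists [mu hmu] (j : 'I_k) : exists b,
    forall q, phi ('X_j * q) = b * phi q.
  have v' := mulfun_vanishing 'X_j v.
  have : fun_row (mulfun 'X_j phi) *m A = th s *: fun_row (mulfun 'X_j phi).
    apply: fun_row_eigen => // q.
    by rewrite -[LHS]/(phi ('X_j * (u * q))) mulrCA; apply: sfun_eigen.
  case/(eigenspace_line th_inj th_eig)/(_ wA w0) => b hb; exists b => q.
  rewrite -[LHS]/(mulfun 'X_j phi q) (vanishing_stair hdeg Tu q v').
  rewrite [phi q](vanishing_stair hdeg Tu q v) mulr_sumr; apply: eq_bigr => e _.
  rewrite mulrCA; congr (_ * _).
  move/rowP/(_ (enum_rank e)): hb; rewrite !mxE enum_rankK => hb.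
  rewrite -[LHS]/(mulfun 'X_j phi _) hb -(sfun_smon hdeg Tu) //.
have pm p : phi p = p.@[mu] * phi 1.
  by have := multiplicative_on_vars hmu p 1; rewrite mulr1.
(* If [phi 1] were zero, [phi] would vanish on every X^e, and these values are the entries of w. *)
have phi1 : phi 1 != 0.
  apply: contraNneq w0 => p1; apply/eqP/rowP=> j.
  rewrite -[j]enum_valK -(sfun_smon hdeg Tu) -[LHS]/(phi _) pm p1.
  by rewrite mulr0 mxE.
exists (finfun mu).
have ev p : p.@[finfun mu] * phi 1 = phi p.
  by rewrite [RHS]pm; congr (_ * _); apply: meval_eq => i; rewrite ffunE.
split=> [i|]; apply: (mulIf phi1); rewrite ev.
  by rewrite mul0r -[h i]mul1r; apply: v.
by rewrite -[u in LHS]mulr1; apply: sfun_eigen.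
Qed.

(** Evaluation at a solution kills the ideal and is an eigenfunctional; it is nonzero because it
    sends 1 to 1. *)
Lemma solution_eigen (mu : 'I_k -> F) :
  (forall i, (h i).@[mu] = 0) -> eigenvalue A u.@[mu].
Proof.
move=> h0; apply/eigenvalueP; exists (fun_row (evalfun mu)).
  apply: fun_row_eigen; first exact: evalfun_vanishing.
  by move=> q; rewrite -[LHS]/((u * q).@[mu]) mevalM.
apply/eqP=> /rowP r0; have : _ = 1.@[mu] := sfun_row 1 (evalfun_vanishing h0).
  rewrite meval1.
rewrite /sfun big1 => [|e _]; last by rewrite r0 mxE mul0r.
by move/esym/eqP; rewrite oner_eq0.
Qed.

(** The two evaluations lie on the same eigenline; comparing them at 1 and then at each variable
    identifies the points. *)
Lemma solution_unique s (mu nu : {ffun 'I_k -> F}) :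
  (forall i, (h i).@[mu] = 0) -> (forall i, (h i).@[nu] = 0) ->
  u.@[mu] = th s -> u.@[nu] = th s -> mu = nu.
Proof.
move=> hm hn um un.
have vm := evalfun_vanishing hm; have vn := evalfun_vanishing hn.
have em : fun_row (evalfun mu) *m A = th s *: fun_row (evalfun mu).
  by apply: fun_row_eigen => // q; rewrite -[LHS]/((u * q).@[mu]) mevalM um.
have en : fun_row (evalfun nu) *m A = th s *: fun_row (evalfun nu).
  by apply: fun_row_eigen => // q; rewrite -[LHS]/((u * q).@[nu]) mevalM un.
have n0 : fun_row (evalfun nu) != 0.
  apply/eqP=> /rowP r0; have : _ = 1.@[nu] := sfun_row 1 vn.
  rewrite meval1.
  rewrite /sfun big1 => [|e _]; last by rewrite r0 mxE mul0r.
  by move/esym/eqP; rewrite oner_eq0.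
have [b hb] := eigenspace_line th_inj th_eig em en n0.
have mb q : q.@[mu] = b * q.@[nu].
  have qm : _ = q.@[mu] := sfun_row q vm.
  have qn : _ = q.@[nu] := sfun_row q vn.
  rewrite -qm -qn hb /sfun mulr_sumr; by apply: eq_bigr => e _; rewrite !mxE mulrA.
have b1 : b = 1 by have := mb 1; rewrite !meval1 mulr1.
by apply/ffunP=> j; have := mb 'X_j; rewrite !mevalXU b1 mul1r.
Qed.

Lemma solution_set : (forall a, eigenvalue A a -> exists i, a = th i) ->
  exists S : seq {ffun 'I_k -> F},
    [/\ uniq S, size S = #|{: stair k}| &
        forall mu : {ffun 'I_k -> F}, (forall i, (h i).@[mu] = 0) <-> mu \in S].
Proof.
move=> eth; have /fin_all_exists [f hf] := eigen_solution.
exists [seq f i | i <- enum 'I_#|{: stair k}|]; split.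
- rewrite map_inj_uniq ?enum_uniq // => i j ij; apply: th_inj.
  by rewrite -(hf i).2 -(hf j).2 ij.
- by rewrite size_map -cardE card_ord.
- move=> mu; split=> [h0|/mapP[i _ ->]]; last exact: (hf i).1.
  have [i mi] := eth _ (solution_eigen h0); apply/mapP; exists i; rewrite ?mem_enum //.
  exact: (solution_unique h0 (hf i).1 mi (hf i).2).
Qed.

End Solutions.

(** * The power sum system *)

(* The exponents e_j are isolated from j = 0 upwards: for fixed s(i), i > j, the
   value x (s j) ranges over j+1 points, while its exponent is at most j. *)
Lemma stair_orbit_independent (k : nat) (A : idomainType) (x : 'I_k -> A)
    (c : stair k -> A) : injective x ->
  (forall s : 'S_k, \sum_e c e * \prod_j x (s j) ^+ e j = 0) ->
  forall e, c e = 0.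
Proof.
move=> xinj c0.
pose agree j (e' e : stair k) := [forall i : 'I_k, (i < j)%N ==> (e i == e' i)].
suff Q j : (j <= k)%N -> forall e' (s : 'S_k),
    \sum_(e | agree j e' e) c e * \prod_(i < k | (j <= i)%N) x (s i) ^+ e i = 0.
  move=> e; have := Q k (leqnn _) e 1%g.
  rewrite (bigD1 e) /=; last by apply/forallP=> i; rewrite eqxx implybT.
  rewrite big_pred0 ?mulr1 => [|i]; last by rewrite leqNgt ltn_ord.
  rewrite big_pred0 ?addr0 // => e'; apply/andP=> -[/forallP ee' /eqP[]].
  by apply/ffunP=> i; have := ee' i; rewrite ltn_ord => /eqP.
elim: j => [|j IHj] jk e' s.
  rewrite -[RHS](c0 s); apply: eq_big => e; last by [].
  by apply/forallP=> i.
pose jj := Ordinal jk.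
pose C (s : 'S_k) (v : 'I_jj.+1) := \sum_(e | agree j e' e && (e jj == v))
   c e * \prod_(i < k | (j < i)%N) x (s i) ^+ e i.
suff CE v : C s v = 0.
  rewrite -[RHS](CE (e' jj)); apply: eq_bigl => e; apply/forallP/andP=> [ee|[]].
    split; last by have := ee jj; rewrite ltnSn.
    by apply/forallP=> i; apply/implyP=> ij; have := ee i; rewrite ltnW.
  move=> /forallP ee ej i; rewrite ltnS leq_eqVlt; apply/implyP=> /orP[/eqP ij|ij].
    by have -> : i = jj by apply: val_inj.
  by have := ee i; rewrite ij.
pose R := \poly_(v < j.+1) C s (inord v).
have rR : all (root R) [seq x (s i) | i : 'I_k <- enum 'I_k & (i <= j)%N].
  rewrite all_map; apply/allP=> i; rewrite mem_filter => /andP[ij _] /=.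
  (* Swapping i and j, both at most j, before applying s leaves the factors at positions beyond j
     alone. The coefficients of [R] stay the same while the point of evaluation becomes x (s i). *)
  have CsE t : C s t = C (tperm i jj * s)%g t.
    apply: eq_bigr => e _; congr (_ * _); apply: eq_bigr => l jl.
    rewrite permM tpermD //; first by apply: contraTneq jl => <-; rewrite -leqNgt.
    by apply: contraTneq jl => <-; rewrite ltnn.
  have := IHj (ltnW jk) e' (tperm i jj * s)%g.
  rewrite (partition_big (fun e : stair k => e jj) predT) //= => sum0.
  rewrite /root horner_poly -[X in _ == X]sum0; apply/eqP.
  apply: eq_bigr => t _; rewrite inord_val CsE mulr_suml; apply: eq_bigr => e.
  move=> /andP[_ /eqP ev]; rewrite -mulrA; congr (_ * _).
  rewrite [RHS](bigD1 jj) //= permM tpermR ev mulrC; congr (_ * _).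
  by apply: eq_bigl => l; rewrite ltn_neqAle andbC eq_sym.
(* [R] has degree at most j and the j+1 distinct roots x (s 0), ..., x (s j). *)
have R0 : R = 0.
  apply/eqP; apply: contraTT isT => Rn0.
  have := max_poly_roots Rn0 rR; rewrite map_inj_in_uniq => [|a b _ _ /xinj/perm_inj //].
  rewrite filter_uniq ?enum_uniq // => /(_ isT).
  rewrite size_map size_filter ltnNge => /negP[].
  apply: leq_trans (size_poly _ _) _.
  rewrite -(count_map val (fun l => l <= j)%N) val_enum_ord -size_filter.
  have := uniq_leq_size (iota_uniq 0 j.+1) (s2 := [seq l <- iota 0 k | (l <= j)%N]).
  rewrite size_iota; apply=> l; rewrite mem_filter !mem_iota /= !add0n ltnS => lj.
  by rewrite lj (leq_ltn_trans lj jk).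
have := coef_poly j.+1 (fun v => C s (inord v)) v.
by rewrite -/R R0 coef0 inord_val ltn_ord => ->.
Qed.

(** * The Jacobian criterion for algebraic independence *)

Section Jacobian.
Variables (k : nat) (F : numFieldType) (h : 'I_k -> {mpoly F[k]}).
Local Notation Phi := (mmap (@mpolyC k F) h).

(** Chain rule. The identity is stable under products and linear combinations, which reduces it to
    the variables. *)
Lemma mderiv_mmap (G : {mpoly F[k]}) j :
  (Phi G)^`M(j) = \sum_i Phi (G^`M(i)) * (h i)^`M(j).
Proof.
pose P (G : {mpoly F[k]}) := (Phi G)^`M(j) = \sum_i Phi (G^`M(i)) * (h i)^`M(j).
have PM p q : P p -> P q -> P (p * q).
  rewrite /P rmorphM mderivM /= => -> ->.
  rewrite mulr_suml mulr_sumr -big_split; apply: eq_bigr => i _ /=.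
  by rewrite mderivM rmorphD !rmorphM /= mulrDl mulrAC mulrA.
have P1 : P 1.
  rewrite /P rmorph1 -mpolyC1 mderivC big1 // => i _.
  by rewrite mderivC rmorph0 mul0r.
suff PG : P G by exact: PG.
rewrite [G]mpolyE; elim/big_ind: _ => [|p q|m _].
- by rewrite /P rmorph0 mderiv0 big1 // => i _; rewrite mderiv0 rmorph0 mul0r.
- rewrite /P rmorphD mderivD /= => -> ->; rewrite -big_split; apply: eq_bigr => i _.
  by rewrite mderivD rmorphD mulrDl.
- have Pm : P 'X_[m].
    rewrite mpolyXE_id; elim/big_ind: _ => // i _; elim: (m i) => // n IHn.
    rewrite exprS; apply: PM => //; rewrite /P (bigD1 i) //= big1 => [|l li].
      rewrite mderivX mnm1E eqxx scale1r addr0.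
      have -> : (U_(i) - U_(i))%MM = 0%MM :> 'X_{1..k}.
        by apply/mnmP=> l; rewrite mnmBE subnn mnm0E.
      by rewrite mpolyX0 rmorph1 mul1r mmapX mmap1U.
    by rewrite mderivX mnm1E eq_sym (negPf li) scale0r rmorph0 mul0r.
  rewrite /P mmapZ mul_mpolyC mderivZ Pm scaler_sumr.
  apply: eq_bigr => i _.
  by rewrite mderivZ mmapZ mul_mpolyC scalerAl.
Qed.

Lemma msize_mderiv (G : {mpoly F[k]}) i n :
  (msize G <= n.+1)%N -> (msize G^`M(i) <= n)%N.
Proof.
move=> Gn; rewrite msizeE; apply/bigmax_leqP_seq => m mG _.
have : (m + U_(i))%MM \in msupp G.
  move: mG; rewrite !mcoeff_msupp mcoeff_deriv; apply: contraNneq => ->.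
  by rewrite mul0rn.
by move/msize_mdeg_lt; rewrite mdegD mdeg1 addn1 => /leq_trans/(_ Gn).
Qed.

(** Differentiating a relation G gives a row of substituted partial derivatives killed by the
    Jacobian matrix. Multiplying by the adjugate shows that each entry is zero, so by induction on
    degree all partials of G vanish. In characteristic zero G is then constant, hence zero. *)
Lemma jacobian_independent : \det (\matrix_(i, j) (h i)^`M(j)) != 0 ->
  forall G, Phi G = 0 -> G = 0.
Proof.
move=> J0 G; move: {2}(msize G) (leqnn (msize G)) => n.
elim: n G => [|n IHn] G Gn G0.
  by apply/eqP; rewrite -msize_poly_eq0 -leqn0.
have dG0 i : G^`M(i) = 0.
  apply: IHn; first exact: msize_mderiv.
  pose v := \row_i Phi (G^`M(i)).
  have vJ : v *m (\matrix_(i, j) (h i)^`M(j)) = 0.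
    apply/rowP=> j; have := mderiv_mmap G j; rewrite G0 mderiv0 => E.
    rewrite !mxE [RHS]E.
    by apply: eq_bigr => l _; rewrite !mxE.
  have : v *m (\matrix_(i, j) (h i)^`M(j)) *m \adj (\matrix_(i, j) (h i)^`M(j)) = 0.
    by rewrite vJ mul0mx.
  rewrite -mulmxA mul_mx_adj mul_mx_scalar => /rowP/(_ i).
  by rewrite !mxE => /eqP; rewrite mulf_eq0 (negPf J0) => /eqP.
have GC : G = (G@_0)%:MP.
  apply/mpolyP=> m; rewrite mcoeffC; case: eqP => [->|/eqP m0]; first by rewrite mulr1.
  have [i mi] : exists i, (0 < m i)%N.
    case: (pickP (fun j => 0 < m j)%N) => [j mj|mz]; first by exists j.
    case/eqP: m0; apply/mnmP=> i; rewrite mnm0E.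
    by have := mz i; case: (m i).
  have := mcoeff_deriv i (m - U_(i))%MM G; rewrite dG0 mcoeff0 submK ?lep1mP -?lt0n //.
  by move/esym/eqP; rewrite mulrn_eq0 /= => /eqP ->; rewrite mulr0.
by move: G0; rewrite GC mmapC => /eqP; rewrite mpolyC_eq0 => /eqP ->.
Qed.

End Jacobian.

(** * Freeness over the shifted power sums *)

Section PowerSums.
Variables (k : nat) (F : numFieldType) (c : 'I_k -> F).

Definition psum (i : 'I_k) : {mpoly F[k]} := \sum_(l < k) 'X_l ^+ i.+1 - (c i)%:MP.

Local Notation Phi := (mmap (@mpolyC k F) psum).

Lemma msize_psum i : (msize (psum i) <= i.+2)%N.
Proof.
apply: msize_leD; last by rewrite msizeN msize_leC.
apply: msize_le_sum => l _; have := @msize_leX k F 'X_l 1 i.+1.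
by rewrite mul1n; apply; rewrite msizeX mdeg1.
Qed.

Lemma msym_psum (s : 'S_k) i : msym s (psum i) = psum i.
Proof.
have symC : msym s (c i)%:MP = (c i)%:MP by apply: mmapC.
rewrite /psum rmorphB rmorph_sum /= symC; congr (_ - _).
rewrite [RHS](reindex_inj (@perm_inj _ s)); apply: eq_bigr => l _.
by rewrite rmorphXn; congr (_ ^+ _); rewrite [LHS]mmapX mmap1U.
Qed.

(** The Jacobian matrix is diag(1, ..., k) times the Vandermonde matrix of the variables. *)
Lemma jacobian_psum : \det (\matrix_(i, j) (psum i)^`M(j)) != 0.
Proof.
pose a : 'rV[{mpoly F[k]}]_k := \row_j 'X_j.
have -> : \matrix_(i, j) (psum i)^`M(j) =
    diag_mx (\row_(i < k) (i.+1)%:R) *m Vandermonde k a.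
  apply/matrixP=> i j; rewrite mul_diag_mx !mxE /psum mderivB mderivC subr0.
  rewrite raddf_sum (bigD1 j) //= big1 ?addr0 => [|l lj].
    rewrite mpolyXn mderivX mulmnE mnm1E eqxx mul1n scaler_nat.
    rewrite mulr_natl mpolyXn; congr (mpolyX _ _ *+ _); apply/mnmP=> l.
    by rewrite mnmBE !mulmnE mulnS addKn.
  by rewrite mpolyXn mderivX mulmnE mnm1E (negPf lj) mul0n scale0r.
rewrite det_mulmx det_diag det_Vandermonde mulf_neq0 //.
  by apply/prodf_neq0 => i _; rewrite mxE -mpolyC_nat mpolyC_eq0 pnatr_eq0.
apply/prodf_neq0 => i _; apply/prodf_neq0 => j ij; rewrite !mxE subr_eq0.
apply/eqP=> /(congr1 (mcoeff U_(j))); rewrite !mcoeffXU eqxx.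
by case: eqP ij => [->|_ _ /eqP]; rewrite ?ltnn ?oner_eq0.
Qed.

(** Terms are grouped by remainder e into X^e times a symmetric polynomial. Independence over the
    permutations removes the X^e, and algebraic independence of the power sums then removes the
    coefficients. *)
Lemma hexp_psum_eq0 b : hexp psum b = 0 -> b = 0.
Proof.
move=> b0; pose d := msize b.
pose Fe (e : stair k) : {mpoly F[k]} := \sum_(n : 'X_{1..k < d} | srem n == e) b@_n *: 'X_[mquo n].
have sum0 : \sum_e 'X_[smon e] * Phi (Fe e) = 0.
  rewrite -[RHS]b0 (hexpE psum (leqnn d)).
  rewrite [RHS](partition_big (fun n : 'X_{1..k < d} => srem n) predT) //=.
  apply: eq_bigr => e _; rewrite rmorph_sum mulr_sumr; apply: eq_bigr => n /eqP <-.
  by rewrite /= mmapZ mmapX mul_mpolyC -scalerAr smon_srem.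
have PhiFe s e : msym s (Phi (Fe e)) = Phi (Fe e).
  move: (Fe e) => G; rewrite [G]mpolyE.
  elim/big_ind: _ => [|p q hp hq|m _]; first by rewrite !rmorph0.
    by rewrite !rmorphD /= hp hq.
  rewrite mmapZ mmapX mul_mpolyC msymZ /mmap1 rmorph_prod; congr (_ *: _).
  by apply: eq_bigr => i _; rewrite rmorphXn /= msym_psum.
have Phi0 : forall e, Phi (Fe e) = 0.
  apply: (@stair_orbit_independent k _ (fun i => 'X_i)).
    move=> i j /(congr1 (mcoeff U_(j))); rewrite !mcoeffXU eqxx.
    by case: eqP => // _ /eqP; rewrite eq_sym oner_eq0.
  (* Permuting the variables by s fixes the symmetric coefficients and moves only X^e, which yields
     one relation for each s. *)
  move=> s; have := congr1 (msym s) sum0; rewrite msym0 => sum0s.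
  rewrite -[RHS]sum0s rmorph_sum; apply: eq_bigr => e _ /=.
  rewrite msymM PhiFe mulrC; congr (_ * _).
  rewrite [RHS]mmapX; apply: eq_bigr => i _.
  by rewrite mnmE.
have Fe0 e : Fe e = 0 := jacobian_independent jacobian_psum (Phi0 e).
apply/mpolyP=> m; rewrite mcoeff0; have [md|dm] := ltnP (mdeg m) d; last first.
  by apply/memN_msupp_eq0/msize_mdeg_ge.
have := congr1 (mcoeff (mquo m)) (Fe0 (srem m)).
rewrite mcoeff0 raddf_sum (bigD1 (BMultinom md)) //= mcoeffZ mcoeffX eqxx mulr1.
rewrite big1 ?addr0 // => n /andP[/eqP nm nE]; rewrite mcoeffZ mcoeffX.
case: eqP => [qm|_]; last by rewrite mulr0.
case/eqP: nE; apply: val_inj => /=.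
by rewrite (mquo_rem n) (mquo_rem m) qm -!smon_srem nm.
Qed.

End PowerSums.

(** * The moment system *)

Section Moments.

Lemma gmomSS (F : pzRingType) (mu s : F) i :
  gmom mu s i.+2 = mu * gmom mu s i.+1 + i.+1%:R * s * gmom mu s i.
Proof. by []. Qed.

Lemma nat_ind2 (P : nat -> Prop) :
  P 0 -> P 1 -> (forall n, P n -> P n.+1 -> P n.+2) -> forall n, P n.
Proof.
by move=> P0 P1 PS n; suff [] : P n /\ P n.+1 by []; elim: n => // n [? ?]; auto.
Qed.

Lemma rmorph_gmom (F F' : pzRingType) (f : {rmorphism F -> F'}) mu s i :
  f (gmom mu s i) = gmom (f mu) (f s) i.
Proof.
elim/nat_ind2: i => [||i IH0 IH1]; rewrite ?gmomSS ?rmorph1 //.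
by rewrite rmorphD !rmorphM rmorph_nat IH0 IH1.
Qed.

Lemma gmom0 (F : pzRingType) (mu : F) i : gmom mu 0 i = mu ^+ i.
Proof.
elim/nat_ind2: i => [||i IH0 IH1] //.
by rewrite gmomSS IH1 mulr0 mul0r addr0 -exprS.
Qed.

Lemma eq_hsys (F : pzRingType) k (lam lam' sig sig' m m' mu mu' : 'I_k -> F) i :
  lam =1 lam' -> sig =1 sig' -> m =1 m' -> mu =1 mu' ->
  hsys lam sig m mu i = hsys lam' sig' m' mu' i.
Proof.
move=> el es em eu; rewrite /hsys em; congr (_ - _).
by apply: eq_bigr => l _; rewrite el es eu.
Qed.

Lemma rmorph_hsys (F F' : pzRingType) (f : {rmorphism F -> F'}) k
    (lam sig m mu : 'I_k -> F) i :
  f (hsys lam sig m mu i) = hsys (f \o lam) (f \o sig) (f \o m) (f \o mu) i.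
Proof.
rewrite /hsys rmorphB rmorph_sum; congr (_ - _).
by apply: eq_bigr => l _; rewrite rmorphM rmorph_gmom.
Qed.

Variables (k : nat) (F : comNzRingType).
Implicit Types lam sig m mu : 'I_k -> F.

(** Taking [hsys] itself over the polynomial ring reduces both evaluation and change of coefficients
    to [rmorph_hsys]. *)
Definition hpoly lam sig m (i : 'I_k) : {mpoly F[k]} :=
  hsys (fun l => (lam l)%:MP) (fun l => (sig l)%:MP) (fun l => (m l)%:MP)
    (fun l => 'X_l) i.

Lemma hpoly_eval lam sig m mu i : (hpoly lam sig m i).@[mu] = hsys lam sig m mu i.
Proof.
rewrite /hpoly (rmorph_hsys (meval mu)).
by apply: eq_hsys => l /=; rewrite ?mevalC ?mevalXU.
Qed.

Lemma msize_gmom (l : 'I_k) (s : F) i : (msize (gmom 'X_l s%:MP i) <= i.+1)%N.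
Proof.
elim/nat_ind2: i => [||i IH0 IH1]; first by rewrite /= msize1.
  by rewrite /= msizeX mdeg1.
rewrite gmomSS; apply: msize_leD.
  by apply: (@msize_leM _ _ _ _ 1 i.+1) => //; rewrite msizeX mdeg1.
apply: leq_trans (_ : i.+1 <= _)%N; last exact: (leq_addl 2).
apply: (@msize_leM _ _ _ _ 0 i) => //.
by rewrite -mpolyC_nat -mpolyCM msize_leC.
Qed.

Lemma msize_hpoly lam sig m i : (msize (hpoly lam sig m i) <= i.+2)%N.
Proof.
apply: msize_leD; last by rewrite msizeN msize_leC.
apply: msize_le_sum => l _; apply: (@msize_leM _ _ _ _ 0 i.+1).
  by rewrite msize_leC.
exact: msize_gmom.
Qed.

End Moments.

Lemma map_hpoly (F F' : comNzRingType) (f : {rmorphism F -> F'}) k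
    (lam sig m : 'I_k -> F) i :
  map_mpoly f (hpoly lam sig m i) = hpoly (f \o lam) (f \o sig) (f \o m) i.
Proof.
rewrite /hpoly (rmorph_hsys (map_mpoly f)).
by apply: eq_hsys => l /=; rewrite ?map_mpolyC ?map_mpolyX.
Qed.

Lemma eq_hmx k (F : comNzRingType) (h h' : 'I_k -> {mpoly F[k]}) d :
  h =1 h' -> hmx h d = hmx h' d.
Proof.
by move=> hh; apply/matrixP=> i j; rewrite !mxE /hbas (mmap1_eq _ hh).
Qed.

(** * The multiplication matrix with entries polynomial in the parameters *)

Section AdjugateMatrix.
Variable k : nat.
Let d := (k * k).+2.

(* The adjugate replaces the inverse of hmx so that the entries stay polynomial in
   the parameters; over a field this multiplies mulmx_stair by the determinant. *)
Definition adjmx_stair (F : comNzRingType) (h : 'I_k -> {mpoly F[k]})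
    (u : {mpoly F[k]}) : 'M[F]_#|{: stair k}| :=
  ((\matrix_(i < #|{: stair k}|) mpoly_row d (u * 'X_[smon (enum_val i)]))
   *m \adj (hmx h d)
   *m (\matrix_(j, i) (bmon j == smon (enum_val i))%:R))^T.

Lemma map_adjmx_stair (F F' : comNzRingType) (f : {rmorphism F -> F'}) h u :
  map_mx f (adjmx_stair h u) =
  adjmx_stair (fun i => map_mpoly f (h i)) (map_mpoly f u).
Proof.
rewrite /adjmx_stair -map_trmx !map_mxM map_mx_adj map_hmx.
congr ((_ *m _ *m _)^T); apply/matrixP=> i j; rewrite !mxE ?rmorph_nat //.
by rewrite -mcoeff_map_mpoly rmorphM /= map_mpolyX.
Qed.

Lemma eq_adjmx_stair (F : comNzRingType) (h h' : 'I_k -> {mpoly F[k]}) u :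
  h =1 h' -> adjmx_stair h u = adjmx_stair h' u.
Proof. by move=> hh; rewrite /adjmx_stair (eq_hmx _ hh). Qed.

(** The coefficient row of q is that of its expansion times [hmx], so the adjugate recovers the
    expansion times the determinant. Since u has degree at most 1, each u X^e has degree below d. *)
Lemma adjmx_stairE (F : fieldType) (h : 'I_k -> {mpoly F[k]})
    (hdeg : forall i, (msize (h i) <= i.+2)%N) (Tu : hmx h d \in unitmx) u :
  (msize u <= 2)%N ->
  adjmx_stair h u = mulmx_stair hdeg Tu (\det (hmx h d) *: u).
Proof.
move=> u2; apply/matrixP=> i j; rewrite mxE [RHS]mxE.
set q := u * 'X_[smon (enum_val j)]; pose c := hinv hdeg Tu q.
have qd : (msize q <= d)%N.
  by apply: (@msize_leM _ _ _ _ 1 (k * k)) => //; rewrite msizeX ltnS mdeg_smon.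
have cd : (msize c <= d)%N.
  have [b bq hb] := hexp_surj hdeg Tu q.
  by rewrite /c -hb hexpK; apply: leq_trans bq qd.
set Row := (X in X *m _ *m _); set Sel := (X in _ *m X).
transitivity (row j (Row *m \adj (hmx h d) *m Sel) 0 i); first by rewrite [RHS]mxE.
have qE : mpoly_row d q = mpoly_row d c *m hmx h d.
  by rewrite -(mpoly_row_hexp h cd) hinvK.
rewrite !row_mul rowK -/q qE -(mulmxA _ (hmx h d)) mul_mx_adj mul_mx_scalar.
rewrite -scalemxAl mxE.
rewrite -scalerAl linearZ mcoeffZ -/q -/c.
have <- : (mpoly_row d c *m Sel) 0 i = c@_(smon (enum_val i)).
  rewrite -[RHS](congr1 (mcoeff _) (mpoly_rowK cd)) /row_mpoly raddf_sum mxE; apply: eq_bigr => l _.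
  by rewrite [RHS]mcoeffZ mcoeffX [Sel _ _]mxE.
by [].
Qed.

End AdjugateMatrix.

(** The shape of the Sylvester matrix depends on the two degrees, which are preserved when the
    leading coefficients survive. *)
Lemma rmorph_resultant (R S : nzRingType) (f : {rmorphism R -> S}) (p q : {poly R}) :
  f (lead_coef p) != 0 -> f (lead_coef q) != 0 ->
  f (resultant p q) = resultant (map_poly f p) (map_poly f q).
Proof.
move=> fp fq; rewrite /resultant /Sylvester_mx !size_map_poly_id0 //.
rewrite -det_map_mx map_col_mx; congr (\det (col_mx _ _));
  by apply: map_lin1_mx => v; rewrite map_poly_rV rmorphM /= map_rVpoly.
Qed.

Lemma lead_coef_deriv_monic (R : nzRingType) (p : {poly R}) n :
  p \is monic -> size p = n.+2 -> n.+1%:R != 0 :> R ->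
  lead_coef p^`() = n.+1%:R.
Proof.
move=> /monicP mp sp n0; have pn : p^`()`_n = n.+1%:R.
  by rewrite coef_deriv -[p`_n.+1]/(p`_n.+2.-1) -sp -lead_coefE mp.
have -> : lead_coef p^`() = p^`()`_n; last by [].
rewrite lead_coefE; congr (_ `_ _); apply/eqP; rewrite -eqSS prednK; last first.
  by rewrite lt0n size_poly_eq0; apply: contraNneq n0 => d0; rewrite -pn d0 coef0.
rewrite eqn_leq; apply/andP; split.
  by rewrite -ltnS -sp lt_size_deriv // -size_poly_eq0 sp.
by rewrite ltnNge; apply: contra n0 => /leq_sizeP/(_ n (leqnn _)); rewrite pn => ->.
Qed.

Lemma digits_inj b k (f g : 'I_k -> nat) :
  (forall i, f i < b)%N -> (forall i, g i < b)%N ->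
  (\sum_(i < k) f i * b ^ i = \sum_(i < k) g i * b ^ i)%N -> f =1 g.
Proof.
elim: k f g => [|k IHk] f g fb gb; first by move=> _ [].
rewrite !big_ord_recl /= !expn0 !muln1.
have shift (h : 'I_k.+1 -> nat) :
    (\sum_(i < k) h (lift ord0 i) * b ^ bump 0 i =
     (\sum_(i < k) h (lift ord0 i) * b ^ i) * b)%N.
  by rewrite big_distrl; apply: eq_bigr => i _ /=; rewrite /bump expnSr mulnA.
rewrite !shift => E; have b0 : (0 < b)%N by apply: leq_ltn_trans (fb ord0).
have E0 : f ord0 = g ord0.
  by have := congr1 (modn^~ b) E; rewrite /= ![(_ ord0 + _)%N]addnC !modnMDl !modn_small.
have E1 := IHk (fun i => f (lift ord0 i)) (fun i => g (lift ord0 i))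
  (fun i => fb _) (fun i => gb _).
move=> i; case: (unliftP ord0 i) => [j ->|->] //; apply: E1.
by move: E; rewrite E0 => /addnI/eqP; rewrite eqn_pmul2r // => /eqP.
Qed.

(** * The polynomial that defines genericity *)

Section Genericity.
Variables (k : nat) (F : numClosedFieldType).
Local Notation n := (k + (k + k))%N.
Local Notation PR := {mpoly F[n]}.
Let d := (k * k).+2.

(* A form whose values on the permutations of (0, ..., k-1) are distinct numbers
   written in base k+1. *)
Definition sepform (R : comNzRingType) : {mpoly R[k]} :=
  \sum_(j < k) ((k.+1 ^ j)%:R)%:MP * 'X_j.

Lemma msize_sepform (R : comNzRingType) : (msize (sepform R) <= 2)%N.
Proof.
apply: msize_le_sum => j _; apply: (@msize_leM _ _ _ _ 0 1); first exact: msize_leC.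
by rewrite msizeX mdeg1.
Qed.

Lemma map_sepform (R R' : comNzRingType) (f : {rmorphism R -> R'}) :
  map_mpoly f (sepform R) = sepform R'.
Proof.
rewrite /sepform rmorph_sum; apply: eq_bigr => j _.
by rewrite rmorphM /= map_mpolyC map_mpolyX; congr (_%:MP * _); apply: rmorph_nat.
Qed.

Lemma sepform_eval (R : comNzRingType) (mu : 'I_k -> R) :
  (sepform R).@[mu] = \sum_(j < k) (k.+1 ^ j)%:R * mu j.
Proof.
rewrite /sepform rmorph_sum; apply: eq_bigr => j _.
by rewrite rmorphM /= mevalC mevalXU.
Qed.

(** The generic parameters are the indeterminates in the order of [params], so evaluation at
    [params] specializes them. *)
Definition lam_gen (l : 'I_k) : PR := 'X_(lshift (k + k) l).
Definition sig_gen (l : 'I_k) : PR := 'X_(rshift k (lshift k l)).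
Definition m_gen (l : 'I_k) : PR := 'X_(rshift k (rshift k l)).

Definition hgen := hpoly lam_gen sig_gen m_gen.
Definition chigen := char_poly (adjmx_stair hgen (sepform PR)).
(** The resultant is, up to sign, the discriminant of the characteristic polynomial. *)
Definition Pgen : PR := \det (hmx hgen d) * resultant chigen chigen^`().

Variables lam sig m : 'I_k -> F.
Let h := hpoly lam sig m.
Let chi := char_poly (adjmx_stair h (sepform F)).

Lemma map_hgen i : map_mpoly (meval (params lam sig m)) (hgen i) = h i.
Proof.
rewrite map_hpoly; apply: eq_hsys => l //=; congr (_ %:MP).
- by rewrite mevalXU /params -[lshift _ _]/(unsplit (inl l)) unsplitK.
- by rewrite mevalXU /params -[rshift _ _]/(unsplit (inr (lshift k l))) unsplitK
    -[lshift _ _]/(unsplit (inl l)) unsplitK.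
- by rewrite mevalXU /params -[rshift _ _]/(unsplit (inr (rshift k l))) unsplitK
    -[rshift _ _]/(unsplit (inr l)) unsplitK.
Qed.

Lemma map_chigen : map_poly (meval (params lam sig m)) chigen = chi.
Proof.
rewrite /chigen /chi map_char_poly map_adjmx_stair map_sepform.
by rewrite (eq_adjmx_stair _ map_hgen).
Qed.

Lemma size_chi : size chi = (k`!).-1.+2.
Proof. by rewrite size_char_poly card_stair prednK ?fact_gt0. Qed.

(** The resultant commutes with specialization because [chigen] is monic and its derivative has
    leading coefficient k!, a nonzero constant. *)
Lemma Pgen_eval :
  Pgen.@[params lam sig m] = \det (hmx h d) * resultant chi chi^`().
Proof.
rewrite /Pgen rmorphM /= -det_map_mx map_hmx (eq_hmx _ map_hgen); congr (_ * _).
have sgen : size chigen = (k`!).-1.+2.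
  by rewrite size_char_poly card_stair prednK ?fact_gt0.
rewrite rmorph_resultant; first by rewrite -deriv_map map_chigen.
  by rewrite (monicP (char_poly_monic _)) rmorph1 oner_neq0.
rewrite (lead_coef_deriv_monic (char_poly_monic _) sgen).
  by rewrite rmorph_nat pnatr_eq0.
by rewrite -mpolyC_nat mpolyC_eq0 pnatr_eq0.
Qed.

Lemma resultant_separable : (resultant chi chi^`() != 0) = separable_poly chi.
Proof.
rewrite resultant_eq0 -leqNgt separable_poly.unlock /coprimep eqn_leq.
rewrite lt0n size_poly_eq0 gcdp_eq0.
by rewrite -[chi == 0]size_poly_eq0 size_chi andbT.
Qed.

Let hdeg := msize_hpoly lam sig m.

Lemma generic_solutions : Pgen.@[params lam sig m] != 0 ->
  exists S : seq {ffun 'I_k -> F},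
    uniq S /\ size S = k`! /\
    forall mu : {ffun 'I_k -> F},
      (forall i : 'I_k, hsys lam sig m mu i = 0) <-> mu \in S.
Proof.
rewrite Pgen_eval mulf_eq0 negb_or resultant_separable => /andP[D0 sep].
have Tu : hmx h d \in unitmx by rewrite unitmxE unitfE.
have AE := adjmx_stairE hdeg Tu (msize_sepform F).
have [rs chiE] := closed_field_poly_normal chi.
have monchi : chi \is monic := char_poly_monic _.
rewrite (monicP monchi) scale1r in chiE.
have urs : uniq rs by rewrite -separable_prod_XsubC -chiE.
have srs : size rs = #|{: stair k}|.
  by apply/eqP; rewrite -eqSS -(size_prod_XsubC rs id) -chiE size_char_poly.
pose th (i : 'I_#|{: stair k}|) := rs`_i.
have rootE a : eigenvalue (adjmx_stair h (sepform F)) a = (a \in rs).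
  by rewrite eigenvalue_root_char -/chi chiE root_prod_XsubC.
(* The form is scaled by the determinant because the adjugate matrix represents multiplication by
   this multiple; the solutions are unaffected. *)
have [||| S [uS sS hS]] := @solution_set k F h hdeg Tu
    (\det (hmx h d) *: sepform F) th.
- move=> i j /eqP; rewrite nth_uniq ?srs // => /eqP; exact: val_inj.
- by move=> i; rewrite -AE rootE mem_nth // srs.
- move=> a; rewrite -AE rootE => ars.
  have ia : (index a rs < #|{: stair k}|)%N by rewrite -srs index_mem.
  by exists (Ordinal ia); rewrite /th /= nth_index.
exists S; split=> //; split; first by rewrite sS card_stair.
move=> mu; rewrite -hS; split=> h0 i; have := h0 i; first by rewrite hpoly_eval.
by rewrite hpoly_eval.
Qed.

End Genericity.

(** * Nonvanishing at the power sums of 0, ..., k-1 *)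

Section SpecialPoint.
Variables (k : nat) (F : numClosedFieldType).
Let d := (k * k).+2.
Let lam (l : 'I_k) : F := 1.
Let sig (l : 'I_k) : F := 0.
Let m (i : 'I_k) : F := \sum_(l < k) (l : nat)%:R ^+ i.+1.
Let h := hpoly lam sig m.

Lemma hpoly_psum i : h i = psum m i.
Proof.
rewrite /h /hpoly /hsys /psum; congr (_ - _); apply: eq_bigr => l _.
by rewrite mpolyC0 gmom0 mpolyC1 mul1r.
Qed.

Lemma special_hmx_unit : hmx h d \in unitmx.
Proof.
rewrite (eq_hmx _ hpoly_psum); apply/(hmx_unitP (@msize_psum k F m)) => c _.
exact: hexp_psum_eq0.
Qed.

Definition special_solution (s : 'S_k) (l : 'I_k) : F := (s l : nat)%:R.

Lemma special_solutionP s i : (h i).@[special_solution s] = 0.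
Proof.
rewrite hpoly_eval /hsys; apply/eqP; rewrite subr_eq0; apply/eqP.
rewrite /m [RHS](reindex_inj (@perm_inj _ s)); apply: eq_bigr => l _.
by rewrite gmom0 mul1r.
Qed.

Lemma special_sepform_inj :
  injective (fun s => (sepform k F).@[special_solution s]).
Proof.
move=> s t; rewrite !sepform_eval /special_solution.
under eq_bigr do rewrite -natrM mulnC.
under [RHS]eq_bigr do rewrite -natrM mulnC.
rewrite -!natr_sum => /eqP; rewrite eqr_nat => /eqP st.
apply/permP=> l; apply: val_inj.
by apply: (digits_inj _ _ st) => i /=; rewrite ltnS ltnW.
Qed.

Lemma Pgen_neq0 : Pgen k F != 0.
Proof.
suff : (Pgen k F).@[params lam sig m] != 0.
  by apply: contraNneq => ->; rewrite meval0.
have Tu := special_hmx_unit; have D0 : \det (hmx h d) != 0.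
  by rewrite -unitfE -unitmxE.
rewrite Pgen_eval mulf_neq0 // resultant_separable.
set chi := char_poly _.
pose f (s : 'S_k) := \det (hmx h d) * (sepform k F).@[special_solution s].
have ufs : uniq [seq f s | s <- enum 'S_k].
  rewrite map_inj_uniq ?enum_uniq // => s t /(mulfI D0).
  exact: special_sepform_inj.
(* The k! permutations give k! distinct eigenvalues, as many as the degree of [chi], so these are
   all its roots and they are simple. *)
have -> : chi = lead_coef chi *: \prod_(z <- [seq f s | s <- enum 'S_k]) ('X - z%:P).
  apply: all_roots_prod_XsubC; last by rewrite uniq_rootsE.
    by rewrite size_char_poly card_stair size_map -cardE card_Sn.
  apply/allP=> _ /mapP[s _ ->]; rewrite -eigenvalue_root_char.
  rewrite (adjmx_stairE (msize_hpoly lam sig m) Tu (msize_sepform k F)).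
  rewrite /f -mevalZ; apply: solution_eigen; exact: special_solutionP.
by rewrite (monicP (char_poly_monic _)) scale1r separable_prod_XsubC.
Qed.

End SpecialPoint.

Theorem mainTheorem9 (R : realType) (k : nat) (hk : (1 <= k)%N) :
  exists P : {mpoly (complex R)[k + (k + k)]},
    P != 0 /\
    forall lam sig m : 'I_k -> complex R,
      P.@[params lam sig m] != 0 ->
      exists S : seq {ffun 'I_k -> complex R},
        uniq S /\ size S = k`! /\
        forall mu : {ffun 'I_k -> complex R},
          (forall i : 'I_k, hsys lam sig m mu i = 0) <-> mu \in S.
Proof.
exists (Pgen k (complex R)); split; first exact: Pgen_neq0.
move=> lam sig m; exact: generic_solutions.
Qed.
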